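(* Let $k\ge 1$. Let $J(x)$ be a complex $k\times 2$ matrix function and $F(x)$ a complex $2\times 2$ matrix function of $x$ such that $J(x)F(x)=J(x_0)$ for all $x$, where $x_0$ is a base point. Let $\widehat J(x)$ (a complex $k\times 2$ matrix function) and $\widehat F(x)$ (a complex $2\times2$ matrix function) be arbitrary approximations of $J$ and $F$. Then for every $x$ $$\widehat J(x)\widehat F(x)-\widehat J(x_0)=J(x)\bigl(\widehat F(x)-F(x)\bigr)+\bigl(\widehat J(x)-J(x)\bigr)\widehat F(x)-\bigl(\widehat J(x_0)-J(x_0)\bigr).$$ Moreover, let $\lVert C\rVert_{\max}$ denote the largest modulus of an entry of a matrix $C$, assume $b=\lVert\widehat J(x_0)\rVert_{\max}>0$, and write $e_F(x)=\lVert\widehat F(x)-F(x)\rVert_{\max}$ and $e_J(x)=\lVert\widehat J(x)-J(x)\rVert_{\max}$. Then for every $x$ $$\frac{\lVert\widehat J(x)\widehat F(x)-\widehat J(x_0)\rVert_{\max}}{b}\le\frac{2\lVert J(x)\rVert_{\max}\,e_F(x)+2\,e_J(x)\,\lVert\widehat F(x)\rVert_{\max}+e_J(x_0)}{b}.$$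
   Context: In the intended application $F$ is the fundamental matrix, normalized by $F(x_0)=I$, of the two-dimensional linearization of a nonlinear ODE of Painlevé type along a given solution, and $J(x)$ is the Jacobian of a vector of $k$ monodromy coordinates ($k=4$ in the paper) with respect to the two-dimensional state, so that conservation of the monodromy data gives $J(x)F(x)=J(x_0)$; $\widehat J$ and $\widehat F$ are computed approximations. *)

(* Defs.v *)
From HB Require Import structures.
From mathcomp Require Export all_boot all_order all_algebra.
From mathcomp Require Export reals normedtype.
From mathcomp Require Export complex.

(* The complex numbers are R[i] for R : realType.
   For C : 'M[R[i]]_(m, n), mx_norm C is the maximum of the moduli `|C i j|.
   Its value has type R[i], as does the modulus `|z| of z : R[i], but it is
   always a nonnegative real; on such elements the (partial) order of R[i] is
   the usual order of the reals. *)

(* Main.v *)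
Require Import Defs.
From mathcomp Require Import interval_inference.
Import Order.TTheory GRing.Theory Num.Theory.
Local Open Scope ring_scope.

(** Since [J x *m F x = J x0], the computed residual splits exactly into the error of [Fhat]
    weighted by [J], the error of [Jhat] weighted by [Fhat], and the error of [Jhat] at the base
    point. The triangle inequality and the product bound [ler_mx_norm_mul] then give the estimate;
    both factors 2 are the inner dimension of the products. *)

Lemma mx_norm_entry (K : numDomainType) m n (A : 'M[K]_(m, n)) i j :
  `|A i j| <= mx_norm A.
Proof.
by rewrite mx_normE -[leLHS]nngE num_le; exact: (le_bigmax _ _ (i, j)).
Qed.

Lemma mx_norm_ge0 (K : numDomainType) m n (A : 'M[K]_(m, n)) : 0 <= mx_norm A.
Proof. by rewrite mx_normE. Qed.

(** The max norm is not submultiplicative: an entry of the product is a sum of [p] terms, each at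
    most the product of the two norms. *)
Lemma ler_mx_norm_mul (K : numDomainType) m p n
    (A : 'M[K]_(m, p)) (B : 'M[K]_(p, n)) :
  mx_norm (A *m B) <= p%:R * mx_norm A * mx_norm B.
Proof.
(* A nonzero norm is attained at some entry; the zero case also covers empty matrices. *)
have [->|/mx_norm_neq0[[i j] ->]] := eqVneq (mx_norm (A *m B)) 0.
  by rewrite !mulr_ge0 ?mx_norm_ge0.
rewrite mxE (le_trans (ler_norm_sum _ _ _)) //.
(* The factor [p] becomes a constant sum over ['I_p], so that the sums compare termwise. *)
rewrite -mulrA mulr_natl -[X in _ *+ X]card_ord -sumr_const.
by apply: ler_sum => l _; rewrite normrM ler_pM ?mx_norm_entry.
Qed.

(** On expanding the right side, the mixed product [A *m B'] cancels, and so does [A *m B] against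
    [C]. *)
Lemma mulmx_residualE (K : pzRingType) m p n
    (A A' : 'M[K]_(m, p)) (B B' : 'M[K]_(p, n)) (C C' : 'M[K]_(m, n)) :
  A *m B = C ->
  A' *m B' - C' = A *m (B' - B) + (A' - A) *m B' - (C' - C).
Proof.
by move=> ABC; rewrite mulmxBr mulmxBl ABC opprB
  (addrC (A *m B' - C)) !subrKA.
Qed.

Theorem mainTheorem2 (R : realType) (X : Type) (x0 : X) (k : nat)
    (hk : (1 <= k)%N)
    (J : X -> 'M[R[i]]_(k, 2)) (F : X -> 'M[R[i]]_2)
    (hJF : forall x : X, J x *m F x = J x0)
    (Jhat : X -> 'M[R[i]]_(k, 2)) (Fhat : X -> 'M[R[i]]_2) :
  (forall x : X,
     Jhat x *m Fhat x - Jhat x0 =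
       J x *m (Fhat x - F x) + (Jhat x - J x) *m Fhat x - (Jhat x0 - J x0)) /\
  (let b := mx_norm (Jhat x0) in
   let eF := fun x : X => mx_norm (Fhat x - F x) in
   let eJ := fun x : X => mx_norm (Jhat x - J x) in
   0 < b ->
   forall x : X,
     mx_norm (Jhat x *m Fhat x - Jhat x0) / b <=
       (2 * mx_norm (J x) * eF x + 2 * eJ x * mx_norm (Fhat x) + eJ x0) / b).
Proof.
have residualE x := mulmx_residualE _ _ _ _ _ (Jhat x) _ (Fhat x) _ (Jhat x0) (hJF x).
split=> // b eF eJ b_gt0 x.
rewrite ler_pM2r ?invr_gt0 // residualE.
(* The base-point error contributes exactly [eJ x0] and cancels from both sides, leaving the two
   products. *)
rewrite (le_trans (ler_mx_norm_add _ _)) // mx_normN lerD2r.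
by rewrite (le_trans (ler_mx_norm_add _ _)) // lerD ?ler_mx_norm_mul.
Qed.
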